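(* Let $K$ be a field, let $H$ be an $m$-hypergraph of size $n$ with vertex set $\{x_1,\dots,x_n\}$, let $x_{i_1},\dots,x_{i_q}$ be distinct vertices of $H$, and let $H'$ be the induced subhypergraph of $H$ on $\{x_{i_1},\dots,x_{i_q}\}$. Then the ideal $(x_{i_1},\dots,x_{i_q})\subset K[x_1,\dots,x_n]$ is an associated prime of $(I(H)^\vee)^2$ if and only if the ideal $(x_{i_1},\dots,x_{i_q})\subset K[x_{i_1},\dots,x_{i_q}]$ is an associated prime of $(I(H')^\vee)^2$.
   Context: An $m$-hypergraph $H$ ($m\ge 1$) consists of a finite vertex set $V$ and an edge set $E$ whose elements are subsets of $V$ with exactly $m$ distinct elements; its size is $|V|$. The vertices are identified with the variables of a polynomial ring over $K$. The edge ideal $I(H)$ is the ideal, in the polynomial ring over $K$ whose variables are the vertices of $H$, generated by the monomials $x_{j_1}\cdots x_{j_m}$ with $\{x_{j_1},\dots,x_{j_m}\}\in E$. Its Alexander dual is $I(H)^\vee=\bigcap_{\{x_{j_1},\dots,x_{j_m}\}\in E}(x_{j_1},\dots,x_{j_m})$, an ideal of the same ring (an empty intersection being the whole ring, which has no associated primes). The induced subhypergraph of $H$ on a subset $U\subset V$ is the $m$-hypergraph with vertex set $U$ whose edges are exactly the edges of $H$ contained in $U$. An associated prime of an ideal $J$ of a ring $R$ means an associated prime of $R/J$. *)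

(* Defs.v *)
From mathcomp Require Import all_boot all_algebra ring_quotient.

Set Implicit Arguments.
Unset Strict Implicit.
Unset Printing Implicit Defensive.

Record hypergraph (m : nat) (V : finType) := Hypergraph {
  edges : {set {set V}};
  edges_card : forall e, e \in edges -> #|e| = m }.

(* An injection i : W -> V labels the vertices of the subset i @: W of V by
   the elements of W; the subhypergraph induced on i @: W is represented on
   the vertex set W (see imset_induced). *)
Section Induced.
Variables (m : nat) (V W : finType) (H : hypergraph m V) (i : W -> V).
Hypothesis i_inj : injective i.

Definition induced_edges : {set {set W}} := [set e : {set W} | i @: e \in edges H].

Lemma induced_edges_card e : e \in induced_edges -> #|e| = m.
Proof. by rewrite inE -(card_imset _ i_inj) => /edges_card. Qed.

Definition induced : hypergraph m W := Hypergraph induced_edges_card.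

Lemma imset_induced :
  [set i @: (e : {set W}) | e in edges induced] =
  [set e in edges H | e \subset i @: [set: W]].
Proof.
apply/setP => e; rewrite inE; apply/imsetP/andP.
- by case=> d; rewrite inE => Hd ->; rewrite imsetS ?subsetT.
- case=> He sub; have E : e = i @: (i @^-1: e).
    apply/setP => x; apply/idP/imsetP.
    + move=> xe; have /imsetP[y _ def_x] := subsetP sub x xe.
      by exists y; rewrite // inE -def_x.
    + by case=> y; rewrite inE => ye ->.
  by exists (i @^-1: e) => //; rewrite inE -E.
Qed.

End Induced.

From mathcomp Require Import boolp classical_sets mpoly.

Import GRing.Theory.
Local Open Scope classical_set_scope.
Local Open Scope ring_scope.

Section Ideals.
Variable R : comNzRingType.
Implicit Types (S I J P : set R).

Definition ideal_gen S : set R :=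
  [set f | exists s : seq (R * R),
     (forall p, p \in s -> S p.2) /\ f = \sum_(p <- s) p.1 * p.2].

Definition ideal_mul I J : set R :=
  ideal_gen [set h | exists2 f, I f & exists2 g, J g & h = f * g].

Definition prime_ideal P : Prop :=
  idealr_closed (mem P) /\ prime_idealr_closed (mem P).

(* The set of all g with g * f in J is the annihilator of the class of f in
   the quotient of R by J. *)
Definition associated_prime J P : Prop :=
  prime_ideal P /\ exists f : R, P = [set g | J (g * f)].

End Ideals.

Definition var_ideal (K : fieldType) (n : nat) (U : {set 'I_n}) :
    set {mpoly K[n]} :=
  ideal_gen [set f | exists2 j, j \in U & f = 'X_j].

Arguments var_ideal K {n} U.

Definition alexander_dual (K : fieldType) (m n : nat)
    (H : hypergraph m 'I_n) : set {mpoly K[n]} :=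
  \bigcap_(e in [set e | e \in edges H]) var_ideal K e.

Arguments alexander_dual K {m n} H.

(* Main.v *)
Require Import Defs.
From mathcomp Require Import all_boot all_algebra.
From mathcomp Require Import boolp classical_sets.
From mathcomp Require Import mpoly.

Set Implicit Arguments.
Unset Strict Implicit.
Unset Printing Implicit Defensive.

(** Both squares are monomial ideals: a polynomial lies in the square of the
Alexander dual of H exactly when each of its monomials is a product of two
monomials that are vertex covers of H (lemma alexander_dual_squareE).

For a monomial ideal J, the prime (U) generated by a set U of variables is
associated to J exactly when (U) is the annihilator of the class of a single
monomial X^u, that is, when x_j X^u is in J for every j in U while X^u times
a monomial free of variables of U never is (lemma associated_primeE). If
(U) = (J : f) and no monomial u of f qualified, each u would admit a monomial w
free of U with X^u X^w in J; the product of these w would multiply f into J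
without being in (U).

It remains to compare the monomials of the two rings when U is the image of i.
Deleting the variables outside U turns a cover of H into a cover of the induced
hypergraph H', since the edges of H' are edges of H. Conversely a cover of H'
becomes a cover of H once it is multiplied by the variables outside U, because
an edge of H not contained in U has a vertex outside U. A product of two covers
of H' therefore becomes a product of two covers of H after multiplication by
the squares of the variables outside U. Hence a monomial u for H restricts to
one for H', and a monomial for H', multiplied by these squares, is one for H
(lemma annihilator_monomial_induced). *)

(** * Monomial ideals and their associated primes *)

Section MonomialIdeals.
Import GRing.Theory.
Local Open Scope ring_scope.
Variables (K : fieldType) (n : nat).
Implicit Types (U : {set 'I_n}) (u v w : 'X_{1..n}) (C : 'X_{1..n} -> Prop).
Implicit Types (f g : {mpoly K[n]}) (S J : set {mpoly K[n]}).

Definition upward_closed C := forall w v, C w -> C (w + v)%MM.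

(** The polynomials all of whose monomials satisfy C; when C is closed under
multiplication by monomials, this is the general monomial ideal. *)
Definition supported C : set {mpoly K[n]} :=
  [set f | forall w, w \in msupp f -> C w]%classic.

Lemma supportedD C f g : supported C f -> supported C g -> supported C (f + g).
Proof.
move=> Cf Cg w /msuppD_le; rewrite mem_cat => /orP[]; [exact: Cf | exact: Cg].
Qed.

Lemma supportedMl C f g :
  upward_closed C -> supported C g -> supported C (f * g).
Proof.
move=> upC Cg w /msuppM_le /allpairsP[[a b] /= [_ bg ->]].
by rewrite addmC; apply/upC/Cg.
Qed.

Lemma supportedX C w : supported C 'X_[w] <-> C w.
Proof.
split=> [|Cw v]; first by apply; rewrite msuppX mem_head.
by rewrite msuppX inE => /eqP ->.
Qed.

Lemma supportedMX C f u :
  supported C (f * 'X_[u]) <-> forall w, w \in msupp f -> C (u + w)%MM.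
Proof.
split=> [Cf w wf | Cf w].
  by apply: Cf; rewrite (perm_mem (msuppMX f u)) map_f.
by rewrite (perm_mem (msuppMX f u)) => /mapP[v vf ->]; apply: Cf.
Qed.

Lemma supported_sum C (T : eqType) (s : seq T) (F : T -> {mpoly K[n]}) :
  (forall x, x \in s -> supported C (F x)) -> supported C (\sum_(x <- s) F x).
Proof.
move=> CF; rewrite big_seq; elim/big_rec: _ => [w|x f xs Cf].
  by rewrite msupp0.
by apply: supportedD => //; apply: CF.
Qed.

(** If the monomials of every generator satisfy C, and each monomial in C is a
monomial multiple of a generator, then the ideal is the monomial ideal of C. *)
Lemma ideal_gen_supported S C : upward_closed C ->
    (forall s, S s -> supported C s) ->
    (forall w, C w -> exists v s, S s /\ 'X_[w] = 'X_[v] * s) ->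
  ideal_gen S = supported C.
Proof.
move=> upC SC CS; apply/seteqP; split=> [f [s [Ss ->]] | f Cf].
  by apply: supported_sum => p /Ss/SC; apply: supportedMl.
have /choice[p Hp] w : exists p : {mpoly K[n]} * {mpoly K[n]},
    w \in msupp f -> S p.2 /\ 'X_[w] = p.1 * p.2.
  have [wf|_] := boolP (w \in msupp f); last by exists (0, 0).
  have [v [s [Ss Ew]]] := CS w (Cf w wf).
  by exists ('X_[v], s) => _; split.
exists [seq (f@_w *: (p w).1, (p w).2) | w <- msupp f]; split=> [q|].
  by case/mapP=> w /Hp[Spw _] ->.
rewrite big_map {1}[f]mpolyE; apply: eq_big_seq => w /Hp[_ ->] /=.
by rewrite scalerAl.
Qed.

(** Some variable of U divides the monomial w. *)
Definition meets U w := [exists j in U, w j != 0%N].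

Lemma meetsP U w : reflect (exists2 j, j \in U & w j != 0%N) (meets U w).
Proof. exact: exists_inP. Qed.

Lemma meets_upward U : upward_closed (meets U).
Proof.
move=> w v /meetsP[j jU wj]; apply/meetsP; exists j => //.
by rewrite mnmDE addn_eq0 negb_and wj.
Qed.

Lemma meetsD U w v : meets U (w + v)%MM = meets U w || meets U v.
Proof.
apply/idP/orP => [/meetsP[j jU]|[/meets_upward->//|]].
  rewrite mnmDE addn_eq0 negb_and => /orP[] ?; [left|right];
    by apply/meetsP; exists j.
by rewrite addmC => /meets_upward->.
Qed.

Lemma split_var w j : w j != 0%N -> exists v, w = (U_(j) + v)%MM.
Proof.
by rewrite -lep1mP => /submK; rewrite addmC => Ew; exists (w - U_(j))%MM.
Qed.

Lemma var_idealE U : var_ideal K U = supported (meets U).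
Proof.
apply: ideal_gen_supported => [|_ [j jU ->]|w].
- exact: meets_upward.
- by apply/supportedX/meetsP; exists j; rewrite ?mnm1E ?eqxx.
case/meetsP=> j jU /split_var[v ->].
by exists v, 'X_j; rewrite addmC mpolyXD; split=> //; exists j.
Qed.

(** The substitution of 0 for the variables of U. Its kernel is the ideal
generated by U, which is therefore prime. *)
Definition zero_vars U : {mpoly K[n]} -> {mpoly K[n]} :=
  mmap (@mpolyC n K) (fun j => if j \in U then 0 else 'X_j).

Lemma zero_varsE U f :
  zero_vars U f = \sum_(w <- msupp f | ~~ meets U w) f@_w *: 'X_[w].
Proof.
rewrite /zero_vars /mmap [RHS]big_mkcond /=; apply: eq_bigr => w _.
rewrite -mul_mpolyC; case: ifPn => [avoid | /negPn/meetsP[j jU wj]].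
  congr (_ * _); rewrite [RHS]mpolyXE_id; apply: eq_bigr => j _.
  case: ifP => // jU; suff /eqP->: w j == 0%N by rewrite !expr0.
  by apply: contraNT avoid => wj; apply/meetsP; exists j.
by rewrite /mmap1 (bigD1 j) //= jU expr0n (negPf wj) mul0r mulr0.
Qed.

Lemma zero_vars_eq0 U f : zero_vars U f = 0 <-> var_ideal K U f.
Proof.
rewrite var_idealE zero_varsE; split=> [f0 w wf | Uf]; last first.
  by rewrite big_seq_cond big_pred0 // => w; apply/andP=> -[/Uf->].
apply: contraT => avoid; have /eqP := congr1 (mcoeff w) f0.
rewrite -big_filter raddf_sum mcoeff0 /=.
rewrite (bigD1_seq w) ?mem_filter ?avoid ?filter_uniq ?msupp_uniq //=.
rewrite mcoeffZ mcoeffX eqxx mulr1 big1 ?addr0 => [|v /negPf vw].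
  by rewrite mcoeff_eq0 wf.
by rewrite mcoeffZ mcoeffX vw mulr0.
Qed.

Lemma prime_var_ideal U : prime_ideal (var_ideal K U).
Proof.
have memE f : (f \in var_ideal K U) = (zero_vars U f == 0).
  by apply/idP/eqP; rewrite inE zero_vars_eq0.
split=> [|f g]; last by rewrite !memE /zero_vars rmorphM mulf_eq0.
split=> [||a f g]; rewrite !memE /zero_vars ?rmorph0 ?rmorph1 ?oner_eq0 //.
by rewrite rmorphD rmorphM /= => /eqP-> /eqP->; rewrite mulr0 addr0.
Qed.

(** Finitely many multipliers free of variables of U can be replaced by a
single one, namely their product. *)
Lemma common_avoiding C U (s : seq 'X_{1..n}) : upward_closed C ->
    (forall u, u \in s -> exists2 w, ~~ meets U w & C (u + w)%MM) ->
  exists2 w, ~~ meets U w & forall u, u \in s -> C (u + w)%MM.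
Proof.
move=> upC; elim: s => [_|u s IHs Cs].
  by exists 0%MM => //; apply/meetsP=> -[j _]; rewrite mnm0E.
have [w aw Cw] := Cs u (mem_head u s).
have [v|v av Cv] := IHs; first by move=> vs; apply: Cs; rewrite inE vs orbT.
exists (w + v)%MM => [|x]; first by rewrite meetsD negb_or aw.
rewrite inE => /predU1P[->|/Cv xv]; first by rewrite addmA; apply: upC.
by rewrite [(w + v)%MM]addmC addmA; apply: upC.
Qed.

(** Some monomial has, modulo the monomial ideal of C, the annihilator generated
by the variables of U. *)
Definition annihilator_monomial C U : Prop :=
  exists u, (forall j, j \in U -> C (u + U_(j))%MM) /\
            (forall w, ~~ meets U w -> ~ C (u + w)%MM).

Lemma associated_primeE C U : upward_closed C ->
  associated_prime (supported C) (var_ideal K U) <-> annihilator_monomial C U.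
Proof.
move=> upC; split=> [[_ [f Pf]] | [u [Cu nCu]]]; last first.
  (* The class of X^u has annihilator (U). *)
  split; [exact: prime_var_ideal | exists 'X_[u]; rewrite var_idealE].
  apply/seteqP; split=> [g gU | g /supportedMX Cg w wg].
    apply/supportedMX => w /gU/meetsP[j jU /split_var[v ->]].
    by rewrite addmA; apply/upC/Cu.
  by apply: contraT => /nCu[]; apply: Cg.
have PE g : var_ideal K U g <-> supported C (g * f) by rewrite Pf.
have varC u j : u \in msupp f -> j \in U -> C (u + U_(j))%MM.
  move=> uf jU; have /PE : var_ideal K U 'X_j.
    rewrite var_idealE; apply/supportedX/meetsP.
    by exists j; rewrite ?mnm1E ?eqxx.
  by rewrite mulrC addmC => /supportedMX; apply.
have [//|nex] := pselect (annihilator_monomial C U).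
(* Otherwise one w free of U multiplies every monomial of f into J, so that
   X^w annihilates f modulo J without being in (U). *)
have [u uf|w aw Cw] := @common_avoiding C U (msupp f) upC.
  apply: contrapT => nw; apply: nex; exists u; split=> [j|w aw Cuw].
    exact: varC.
  by apply: nw; exists w.
suff /PE : supported C ('X_[w] * f).
  by rewrite var_idealE => /supportedX; rewrite (negPf aw).
by rewrite mulrC; apply/supportedMX => u uf; rewrite addmC; apply: Cw.
Qed.

End MonomialIdeals.

(** * The square of the Alexander dual *)

Section Covers.
Import GRing.Theory.
Local Open Scope ring_scope.
Variables (m n : nat) (H : hypergraph m 'I_n).
Implicit Types (u v w : 'X_{1..n}).

(** The support of w is a vertex cover of H. *)
Definition covers w := [forall e in edges H, meets e w].

Lemma coversP w : reflect (forall e, e \in edges H -> meets e w) (covers w).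
Proof. exact: forall_inP. Qed.

Lemma covers_upward : upward_closed covers.
Proof.
move=> w v /coversP cw; apply/coversP => e /cw; exact: meets_upward.
Qed.

(** The monomial w is a product of two vertex covers. *)
Definition double_cover w : Prop :=
  exists a b, [/\ covers a, covers b & w = (a + b)%MM].

Lemma double_cover_upward : upward_closed double_cover.
Proof.
move=> w v [a [b [ca cb ->]]]; exists a, (b + v)%MM.
by rewrite addmA; split=> //; apply: covers_upward.
Qed.

Variable K : fieldType.

Lemma alexander_dualE : alexander_dual K H = supported covers.
Proof.
apply/seteqP; split=> f Hf => [w wf | e /= eH].
  by apply/coversP => e eH; move: (Hf e eH); rewrite var_idealE; apply.
by rewrite var_idealE => w /Hf/coversP; apply.
Qed.

Lemma alexander_dual_squareE :
  ideal_mul (alexander_dual K H) (alexander_dual K H) = supported double_cover.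
Proof.
rewrite alexander_dualE; apply: ideal_gen_supported.
- exact: double_cover_upward.
- move=> _ [f Hf [g Hg ->]] w /msuppM_le/allpairsP[[a b] /= [af bg ->]].
  by exists a, b; split=> //; [apply: Hf | apply: Hg].
move=> _ [a [b [ca cb ->]]]; exists 0%MM, ('X_[a] * 'X_[b]).
rewrite mpolyX0 mul1r mpolyXD; split=> //.
exists 'X_[a]; first exact/supportedX.
by exists 'X_[b]; first exact/supportedX.
Qed.

End Covers.

(** * Passage to the induced hypergraph *)

Section Induced.
Variables (m n q : nat) (H : hypergraph m 'I_n) (i : 'I_q -> 'I_n).
Hypothesis i_inj : injective i.
Let U : {set 'I_n} := i @: [set: 'I_q].
Let H' := induced H i_inj.

(** The monomial in the variables of H' obtained by setting the variables outside
U to 1. *)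
Definition restrict (w : 'X_{1..n}) : 'X_{1..q} := [multinom w (i j) | j < q].

(** The image of w under i, times the c-th power of each variable outside U. *)
Definition extend c (w : 'X_{1..q}) : 'X_{1..n} :=
  [multinom (if [pick j | i j == k] is Some j then w j else c) | k < n].

Lemma extend_in c w j : extend c w (i j) = w j.
Proof.
rewrite mnmE; case: pickP => [k /eqP/i_inj-> //|/(_ j)].
by rewrite eqxx.
Qed.

Lemma extend_out c w k : k \notin U -> extend c w k = c.
Proof.
rewrite mnmE; case: pickP => // j /eqP <-.
by rewrite imset_f ?inE.
Qed.

Lemma extendD c d v w : extend (c + d) (v + w)%MM = (extend c v + extend d w)%MM.
Proof. by apply/mnmP => k; rewrite !mnmE; case: pickP => // j _; rewrite mnmE. Qed.

Lemma restrictD v w : restrict (v + w)%MM = (restrict v + restrict w)%MM.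
Proof. by apply/mnmP => j; rewrite !mnmE. Qed.

Lemma extendK c : cancel (extend c) restrict.
Proof. by move=> w; apply/mnmP => j; rewrite mnmE extend_in. Qed.

Lemma restrict1 j : restrict U_(i j)%MM = U_(j)%MM.
Proof. by apply/mnmP => k; rewrite !mnmE (inj_eq i_inj). Qed.

Lemma restrict_avoiding w : ~~ meets U w -> restrict w = 0%MM.
Proof.
move=> aw; apply/mnmP => j; rewrite mnmE mnm0E; apply/eqP.
by apply: contraNT aw => wj; apply/meetsP; exists (i j); rewrite ?imset_f ?inE.
Qed.

Lemma covers_restrict w : covers H w -> covers H' (restrict w).
Proof.
move/coversP=> cw; apply/coversP => e.
rewrite inE => /cw/meetsP[_ /imsetP[j je ->] wj].
by apply/meetsP; exists j; rewrite ?mnmE.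
Qed.

Lemma covers_extend w : covers H' w -> covers H (extend 1 w).
Proof.
move/coversP=> cw; apply/coversP => e eH; have [eU|] := boolP (e \subset U).
  have : e \in [set e in edges H | e \subset U] by rewrite inE eH.
  rewrite -(imset_induced H i_inj) => /imsetP[d /cw/meetsP[j jd wj] ->].
  by apply/meetsP; exists (i j); rewrite ?imset_f ?extend_in.
by case/subsetPn=> k ke kU; apply/meetsP; exists k; rewrite ?extend_out.
Qed.

Lemma double_cover_restrict w : double_cover H w -> double_cover H' (restrict w).
Proof.
case=> a [b [ca cb ->]]; exists (restrict a), (restrict b).
by rewrite restrictD; split=> //; apply: covers_restrict.
Qed.

Lemma double_cover_extend w : double_cover H' w -> double_cover H (extend 2 w).
Proof.
case=> a [b [ca cb ->]]; exists (extend 1 a), (extend 1 b).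
by rewrite -extendD; split=> //; apply: covers_extend.
Qed.

Lemma annihilator_monomial_induced :
  annihilator_monomial (double_cover H) U <->
  annihilator_monomial (double_cover H') [set: 'I_q].
Proof.
split=> -[u [Cu nCu]].
  exists (restrict u); split=> [j _|w aw].
    rewrite -restrict1 -restrictD.
    by apply/double_cover_restrict/Cu/imset_f; rewrite inE.
  (* A monomial of the smaller ring free of all the variables is 1. *)
  have -> : w = 0%MM.
    apply/mnmP => j; rewrite mnm0E; apply/eqP; apply: contraNT aw => wj.
    by apply/meetsP; exists j; rewrite ?inE.
  (* If restrict u were a double cover, so would be u times the squares of the
     variables outside U, against the choice of u. *)
  move/double_cover_extend; rewrite addm0 => Cx.
  apply: (nCu (extend 2 0%MM)).
    apply/meetsP=> -[_ /imsetP[j _ ->]].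
    by rewrite extend_in mnm0E.
  have -> : (u + extend 2 0 = extend 2 (restrict u) + (u - extend 0 (restrict u)))%MM.
    apply/mnmP => k; rewrite !mnmE; case: pickP => [j /eqP <-|_].
      by rewrite !mnmE addn0 subnn addn0.
    by rewrite subn0 addnC.
  exact: double_cover_upward.
exists (extend 2 u); split=> [_ /imsetP[j _ ->]|w aw /double_cover_restrict].
  have -> : (extend 2 u + U_(i j) = extend 2 (u + U_(j)))%MM.
    rewrite -[in RHS](addn0 2) extendD; congr (_ + _)%MM; apply/mnmP => k.
    rewrite !mnmE; case: pickP => [l /eqP <-|/(_ j) -> //].
    by rewrite mnmE (inj_eq i_inj).
  by apply/double_cover_extend/Cu; rewrite inE.
rewrite restrictD extendK restrict_avoiding // => Cu0; apply: nCu Cu0.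
by apply/meetsP=> -[j _]; rewrite mnm0E.
Qed.

End Induced.

Theorem theorem1p6 (K : fieldType) (m n q : nat) (m_gt0 : 0 < m)
    (H : hypergraph m 'I_n) (i : 'I_q -> 'I_n) (i_inj : injective i) :
  associated_prime
    (ideal_mul (alexander_dual K H) (alexander_dual K H))
    (var_ideal K (i @: [set: 'I_q])%SET)
  <->
  associated_prime
    (ideal_mul (alexander_dual K (induced H i_inj))
               (alexander_dual K (induced H i_inj)))
    (var_ideal K [set: 'I_q]%SET).
Proof.
rewrite !alexander_dual_squareE.
rewrite !associated_primeE; try exact: double_cover_upward.
exact: annihilator_monomial_induced.
Qed.
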